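(* Let $G$ be a countable group and $\mathcal F_G$ the family of finite subsets of $G$, and identify $\mathcal P_G$ with the compact metrizable space $2^G$ (product topology). Then for every countable ordinal $\alpha$ the set $\tau^\alpha(\mathcal F_G)$ is Borel in $\mathcal P_G$, and $\tau^*(\mathcal F_G)=\tau^{<\omega_1}(\mathcal F_G)$ is coanalytic in $\mathcal P_G$. If moreover $G$ contains an element of infinite order, then $\tau^*(\mathcal F_G)$ is not analytic (in particular, not Borel).
   Context: Subsets $A\subset G$ are identified with their characteristic functions $\chi_A\in 2^G$. For a left-invariant lower family $\mathcal F\subset\mathcal P_G$: $\tau(\mathcal F)=\{A\subset G: xA\cap yA\in\mathcal F$ for all distinct $x,y\in G\}$; $\tau^0(\mathcal F)=\mathcal F$, $\tau^{<\alpha}(\mathcal F)=\bigcup_{\beta<\alpha}\tau^\beta(\mathcal F)$, $\tau^\alpha(\mathcal F)=\tau(\tau^{<\alpha}(\mathcal F))$ for $\alpha>0$. The thin-completion $\tau^*(\mathcal F)$ is the smallest family $\tilde{\mathcal F}\supset\mathcal F$ with $\tau(\tilde{\mathcal F})=\tilde{\mathcal F}$. A subset of a Polish space is analytic if it is a continuous image of a Polish space, and coanalytic if its complement is analytic. *)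

(* Defs.v *)
From Stdlib Require Import Reals List.
Open Scope R_scope.

Record Group := {
  gcar :> Type;
  gmul : gcar -> gcar -> gcar;
  gone : gcar;
  ginv : gcar -> gcar;
  gmul_assoc : forall x y z, gmul x (gmul y z) = gmul (gmul x y) z;
  gmul_1l : forall x, gmul gone x = x;
  gmul_1r : forall x, gmul x gone = x;
  gmul_Vl : forall x, gmul (ginv x) x = gone;
  gmul_Vr : forall x, gmul x (ginv x) = gone
}.

Definition countable_type (T : Type) : Prop :=
  exists e : T -> nat, forall x y, e x = e y -> x = y.

Fixpoint gpow (G : Group) (g : G) (n : nat) : G :=
  match n with O => gone G | S k => gmul G g (gpow G g k) end.

Definition infinite_order (G : Group) (g : G) : Prop :=
  forall n : nat, (0 < n)%nat -> gpow G g n <> gone G.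

Definition PG (G : Group) := G -> bool.
Definition family (G : Group) := PG G -> Prop.

Definition ltrans (G : Group) (x : G) (A : PG G) : PG G :=
  fun g => A (gmul G (ginv G x) g).
Definition sinter (G : Group) (A B : PG G) : PG G := fun g => andb (A g) (B g).

Definition finite_sets (G : Group) : family G :=
  fun A => exists l : list G, forall g, A g = true -> In g l.

Definition tau (G : Group) (F : family G) : family G :=
  fun A => forall x y : G, x <> y -> F (sinter G (ltrans G x A) (ltrans G y A)).

(* ---------- Countable ordinals (Brouwer trees) ---------- *)
Inductive ord : Type :=
| ozero : ord
| osucc : ord -> ord
| olim : (nat -> ord) -> ord.

(* tau^alpha given tau^{<alpha} *)
Definition tau_at (G : Group) (F : family G) (a : ord) (Lt : family G) : family G :=
  match a with ozero => F | _ => tau G Lt end.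

Fixpoint tau_lt (G : Group) (F : family G) (a : ord) : family G :=
  match a with
  | ozero => fun _ => False
  | osucc b => fun A => tau_lt G F b A \/ tau_at G F b (tau_lt G F b) A
  | olim f => fun A => exists n, tau_lt G F (f n) A \/
                               tau_at G F (f n) (tau_lt G F (f n)) A
  end.

Definition tau_iter (G : Group) (F : family G) (a : ord) : family G :=
  tau_at G F a (tau_lt G F a).

Definition tau_lt_omega1 (G : Group) (F : family G) : family G :=
  fun A => exists a : ord, tau_iter G F a A.

Definition tau_star (G : Group) (F : family G) : family G :=
  fun A => forall Phi : family G,
      (forall B, F B -> Phi B) ->
      (forall B, tau G Phi B <-> Phi B) -> Phi A.

Definition open2G (G : Group) (U : family G) : Prop :=
  forall A, U A -> exists S : list G,
      forall B, (forall g, In g S -> B g = A g) -> U B.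

Inductive borel (G : Group) : family G -> Prop :=
| borel_open : forall U, open2G G U -> borel G U
| borel_compl : forall E, borel G E -> borel G (fun A => ~ E A)
| borel_cunion : forall E : nat -> family G, (forall n, borel G (E n)) ->
                 borel G (fun A => exists n, E n A).

Record polish_space := {
  pcar :> Type;
  pd : pcar -> pcar -> R;
  pd_nonneg : forall x y, 0 <= pd x y;
  pd_eq0 : forall x y, pd x y = 0 <-> x = y;
  pd_sym : forall x y, pd x y = pd y x;
  pd_tri : forall x y z, pd x z <= pd x y + pd y z;
  p_separable : exists s : nat -> option pcar,
      forall x eps, 0 < eps -> exists n y, s n = Some y /\ pd x y < eps;
  p_complete : forall u : nat -> pcar,
      (forall eps, 0 < eps -> exists N, forall m n, (m >= N)%nat -> (n >= N)%nat ->
         pd (u m) (u n) < eps) ->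
      exists l, forall eps, 0 < eps -> exists N, forall n, (n >= N)%nat -> pd (u n) l < eps
}.

Definition p_open (X : polish_space) (V : X -> Prop) : Prop :=
  forall x, V x -> exists eps, 0 < eps /\ forall y, pd X x y < eps -> V y.

Definition continuous_to_2G (G : Group) (X : polish_space) (f : X -> PG G) : Prop :=
  forall U : family G, open2G G U -> p_open X (fun x => U (f x)).

Definition analytic (G : Group) (E : family G) : Prop :=
  exists (X : polish_space) (f : X -> PG G), continuous_to_2G G X f /\
    forall A, E A <-> exists x, f x = A.

Definition coanalytic (G : Group) (E : family G) : Prop :=
  analytic G (fun A => ~ E A).

(* Main.v *)
(** Writing [xA ∩ yA = x(A ∩ x^-1 y A)], membership of [A] in the thin-completion means
    that no sequence of nontrivial shifts [k_n] keeps all iterated intersections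
    [D_{n+1} = D_n ∩ k_n D_n], [D_0 = A], infinite; such sequences form a closed subset of
    Baire space, so the complement is analytic.

    If [g] has infinite order, send a tree to the set of all [g^N] where [N] is a sum of
    distinct powers [4^k], [k] running through the codes of a finite chain of the tree.
    An infinite branch supplies the shifts [g^(-4^k)] along it, which never terminate.
    Conversely each shift of a never terminating sequence is [g^d] for an integer [d] whose
    leading base four digit singles out a node; these nodes are distinct and pairwise
    comparable, hence span an infinite branch.  The thin-completion therefore pulls back
    to the set of codes of well-founded trees, and a diagonal argument shows that this set
    is not analytic. *)
From Stdlib Require Import Reals List Lra Lia Arith ZArith Cantor FinFun.
From Stdlib Require Import Classical ClassicalEpsilon FunctionalExtensionality.
From Stdlib Require Import PropExtensionality.
Require Import Defs.

Local Open Scope nat_scope.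

(** * Truth values of propositions and injective sequences *)

Definition pbool (P : Prop) : bool :=
  if excluded_middle_informative P then true else false.

Lemma pboolP (P : Prop) : pbool P = true <-> P.
Proof. unfold pbool; destruct excluded_middle_informative; intuition congruence. Qed.

Lemma pbool_iff (P Q : Prop) : (P <-> Q) -> pbool P = pbool Q.
Proof.
  intros H; unfold pbool.
  destruct (excluded_middle_informative P), (excluded_middle_informative Q); tauto.
Qed.

Lemma injective_not_in_list (X : Type) (f : nat -> X) (l : list X) :
  (forall i j, f i = f j -> i = j) -> ~ (forall i, In (f i) l).
Proof.
  intros Hf Hl.
  assert (Hn : NoDup (map f (seq 0 (S (length l))))).
  { apply FinFun.Injective_map_NoDup; [exact Hf | apply seq_NoDup]. }
  assert (Hi : incl (map f (seq 0 (S (length l)))) l).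
  { intros x Hx; apply in_map_iff in Hx; destruct Hx as [i [<- _]]; apply Hl. }
  pose proof (NoDup_incl_length Hn Hi) as H.
  rewrite length_map, length_seq in H; lia.
Qed.

Lemma injective_unbounded (f : nat -> nat) :
  (forall i j, f i = f j -> i = j) -> forall n, exists i, n <= f i.
Proof.
  intros Hf n; apply NNPP; intros H.
  apply (injective_not_in_list nat f (seq 0 n) Hf); intros i.
  apply in_seq; split; [lia|].
  apply Nat.nle_gt; intros Hi; apply H; exists i; exact Hi.
Qed.

(** * Translates and thin-well-foundedness *)

Section Group.
Variable G : Group.
Implicit Types (A B : PG G) (x y k : G).

Local Notation "x ** y" := (gmul G x y) (at level 40, left associativity).
Local Notation one := (gone G).
Local Notation inv := (ginv G).

Lemma gmul_cancel_l x y z : x ** y = x ** z -> y = z.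
Proof.
  intros H; rewrite <- (gmul_1l G y), <- (gmul_1l G z), <- (gmul_Vl G x).
  rewrite <- !gmul_assoc, H; reflexivity.
Qed.

Lemma gmul_cancel_r x y z : y ** x = z ** x -> y = z.
Proof.
  intros H; rewrite <- (gmul_1r G y), <- (gmul_1r G z), <- (gmul_Vr G x).
  rewrite !gmul_assoc, H; reflexivity.
Qed.

Lemma gmul_KVl x y : x ** (inv x ** y) = y.
Proof. rewrite gmul_assoc, gmul_Vr, gmul_1l; reflexivity. Qed.

Lemma ginv_mul x y : inv (x ** y) = inv y ** inv x.
Proof.
  apply (gmul_cancel_l (x ** y)); rewrite gmul_Vr, <- gmul_assoc, gmul_KVl, gmul_Vr.
  reflexivity.
Qed.

Lemma ginv_inv x : inv (inv x) = x.
Proof. apply (gmul_cancel_l (inv x)); rewrite gmul_Vr, gmul_Vl; reflexivity. Qed.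

Definition capshift k A : PG G := sinter G A (ltrans G k A).

Lemma capshiftE k A p : capshift k A p = true <-> A p = true /\ A (inv k ** p) = true.
Proof. unfold capshift, sinter, ltrans; rewrite Bool.andb_true_iff; tauto. Qed.

Lemma sinter_ltrans x y A :
  sinter G (ltrans G x A) (ltrans G y A) = ltrans G x (capshift (inv x ** y) A).
Proof.
  apply functional_extensionality; intros p.
  unfold capshift, sinter, ltrans; do 2 f_equal.
  rewrite ginv_mul, ginv_inv, <- gmul_assoc, gmul_KVl; reflexivity.
Qed.

(** Moving the translation outside conjugates the shift, and conjugates of nontrivial elements are
    nontrivial; this lets inductions treat all translates of a set at once. *)
Lemma capshift_ltrans x k A :
  capshift k (ltrans G x A) = ltrans G x (capshift (inv x ** k ** x) A).
Proof.
  apply functional_extensionality; intros p.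
  unfold capshift, sinter, ltrans; do 2 f_equal.
  rewrite !ginv_mul, ginv_inv, <- !gmul_assoc, gmul_KVl; reflexivity.
Qed.

Lemma ltrans1 A : ltrans G one A = A.
Proof.
  apply functional_extensionality; intros p; unfold ltrans.
  rewrite <- (gmul_1l G (inv one)), gmul_Vr, gmul_1l; reflexivity.
Qed.

Lemma ltrans_ltrans x y A : ltrans G x (ltrans G y A) = ltrans G (x ** y) A.
Proof.
  apply functional_extensionality; intros p; unfold ltrans.
  rewrite ginv_mul, gmul_assoc; reflexivity.
Qed.

Lemma finite_ltrans x A : finite_sets G A -> finite_sets G (ltrans G x A).
Proof.
  intros [l Hl]; exists (map (gmul G x) l); intros p Hp.
  apply in_map_iff; exists (inv x ** p); split; [apply gmul_KVl | apply Hl, Hp].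
Qed.

Lemma finite_subset A B :
  (forall p, B p = true -> A p = true) -> finite_sets G A -> finite_sets G B.
Proof. intros H [l Hl]; exists l; intros p Hp; apply Hl, H, Hp. Qed.

(** Well-foundedness of the tree of nontrivial shifts; its induction principle replaces an ordinal
    rank. *)
Inductive thin_wf : PG G -> Prop :=
| thin_wf_finite A : finite_sets G A -> thin_wf A
| thin_wf_step A : (forall k, k <> one -> thin_wf (capshift k A)) -> thin_wf A.

Lemma thin_wf_capshift k A : k <> one -> thin_wf A -> thin_wf (capshift k A).
Proof.
  intros Hk [B HB | B HB]; [|apply HB, Hk].
  apply thin_wf_finite, (finite_subset B); [|exact HB].
  intros p Hp; apply capshiftE in Hp; tauto.
Qed.

Lemma thin_wf_ltrans A : thin_wf A -> forall x, thin_wf (ltrans G x A).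
Proof.
  induction 1 as [A HA | A _ IH]; intros x.
  - apply thin_wf_finite, finite_ltrans, HA.
  - apply thin_wf_step; intros k Hk; rewrite capshift_ltrans; apply IH.
    intros H; apply Hk; apply (gmul_cancel_l (inv x)), (gmul_cancel_r x).
    rewrite H, gmul_1r, gmul_Vl; reflexivity.
Qed.

(** [thin_wf] is a fixed point of [tau] containing the finite sets, which gives one inclusion;
    induction on [thin_wf] places it inside every other such fixed point. *)
Lemma tau_starP A : tau_star G (finite_sets G) A <-> thin_wf A.
Proof.
  split.
  - intros H; apply H; [exact thin_wf_finite |].
    intros B; split; intros HB.
    + apply thin_wf_step; intros k Hk.
      specialize (HB one k (fun e => Hk (eq_sym e))); rewrite ltrans1 in HB; exact HB.
    + intros x y Hxy; rewrite sinter_ltrans; apply thin_wf_ltrans, thin_wf_capshift, HB.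
      intros H'; apply Hxy, (gmul_cancel_l (inv x)); rewrite H', gmul_Vl; reflexivity.
  - intros HA Phi HF Htau.
    (* [Phi] need not be left-invariant, hence all translates at once. *)
    enough (H : forall x, Phi (ltrans G x A)) by (rewrite <- (ltrans1 A); apply H).
    induction HA as [A HA | A _ IH]; intros z.
    + apply HF, finite_ltrans, HA.
    + apply Htau; intros x y Hxy.
      rewrite sinter_ltrans, capshift_ltrans, ltrans_ltrans; apply IH.
      intros H; apply Hxy, (gmul_cancel_l (inv x)), (gmul_cancel_l (inv z)).
      apply (gmul_cancel_r z).
      rewrite H, gmul_Vl, gmul_1r, gmul_Vl; reflexivity.
Qed.

(** * Transfinite iterates of [tau] *)

Lemma tau_mono (E F : family G) : (forall A, E A -> F A) -> forall A, tau G E A -> tau G F A.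
Proof. intros H A HA x y Hxy; apply H, HA, Hxy. Qed.

Lemma tau_lt_iter (F : family G) a A : tau_lt G F a A -> exists b, tau_iter G F b A.
Proof.
  induction a as [| a IH | f IH]; simpl.
  - intros [].
  - intros [H | H]; [exact (IH H) | exists a; exact H].
  - intros [n [H | H]]; [exact (IH n H) | exists (f n); exact H].
Qed.

Lemma tau_iter_sub_fixpoint (F Phi : family G) :
  (forall B, F B -> Phi B) -> (forall B, tau G Phi B -> Phi B) ->
  forall a A, tau_iter G F a A -> Phi A.
Proof.
  intros HF Htau.
  (* One stage is settled from the stages below it; the recursion itself runs over [tau_lt]. *)
  assert (Hat : forall a, (forall A, tau_lt G F a A -> Phi A) ->
                forall A, tau_iter G F a A -> Phi A).
  { intros [| a | f] H A; unfold tau_iter, tau_at.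
    - apply HF.
    - intros HA; apply Htau; revert HA; apply tau_mono, H.
    - intros HA; apply Htau; revert HA; apply tau_mono, H. }
  intros a; apply Hat; induction a as [| a IH | f IH]; simpl; intros A.
  - intros [].
  - intros [H | H]; [exact (IH A H) | exact (Hat a IH A H)].
  - intros [n [H | H]]; [exact (IH n A H) | exact (Hat (f n) (IH n) A H)].
Qed.

Lemma finite_tau A : finite_sets G A -> tau G (finite_sets G) A.
Proof.
  intros HA x y _; apply (finite_subset (ltrans G x A)); [|apply finite_ltrans, HA].
  intros p Hp; apply Bool.andb_true_iff in Hp; tauto.
Qed.

(** * Iterated intersections along a sequence of shifts *)

Fixpoint der (k : nat -> G) A (n : nat) : PG G :=
  match n with O => A | S m => capshift (k m) (der k A m) end.

(** Absorbing the first shift into the starting set leaves the tail of the sequence, the form that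
    an induction on [thin_wf] can consume. *)
Lemma der_shift (k : nat -> G) A n : der k A (S n) = der (fun i => k (S i)) (capshift (k O) A) n.
Proof. induction n as [| n IH]; [reflexivity|]; simpl in *; rewrite IH; reflexivity. Qed.

(** Dependent choice: a set outside [thin_wf] has a nontrivial shift whose intersection stays
    outside. Conversely, each step of a [thin_wf] derivation removes the head of the sequence, until
    a finite set is reached. *)
Lemma not_thin_wfP A :
  ~ thin_wf A <->
  exists k : nat -> gcar G, (forall n, k n <> one) /\ forall n, ~ finite_sets G (der k A n).
Proof.
  split.
  - intros HA.
    assert (Hstep : forall B : {B | ~ thin_wf B},
               exists k, k <> one /\ ~ thin_wf (capshift k (proj1_sig B))).
    { intros [B HB]; simpl; apply NNPP; intros H; apply HB, thin_wf_step; intros k Hk.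
      apply NNPP; intros Hn; apply H; exists k; split; assumption. }
    pose (next := fun C => constructive_indefinite_description _ (Hstep C)).
    pose (step := fun C => exist (fun B => ~ thin_wf B)
                    (capshift (proj1_sig (next C)) (proj1_sig C))
                    (proj2 (proj2_sig (next C)))).
    pose (b := fun n => Nat.iter n step (exist (fun B => ~ thin_wf B) A HA)).
    exists (fun n => proj1_sig (next (b n))); split.
    + intros n; exact (proj1 (proj2_sig (next (b n)))).
    + assert (Hb : forall n, der (fun n => proj1_sig (next (b n))) A n = proj1_sig (b n)).
      { induction n as [| n IH]; [reflexivity|]; simpl; rewrite IH; reflexivity. }
      intros n Hn; rewrite Hb in Hn; exact (proj2_sig (b n) (thin_wf_finite _ Hn)).
  - intros (k & Hk & Hd) HA; revert k Hk Hd.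
    induction HA as [A HA | A _ IH]; intros k Hk Hd.
    + exact (Hd O HA).
    + apply (IH (k O) (Hk O) (fun i => k (S i))); [intros n; apply Hk|].
      intros n; rewrite <- der_shift; apply Hd.
Qed.

(** * Closure properties of Borel families *)

Lemma borel_ext (E F : family G) : (forall A, E A <-> F A) -> borel G E -> borel G F.
Proof.
  intros H; replace F with E; [auto|].
  apply functional_extensionality; intros A; apply propositional_extensionality, H.
Qed.

Lemma borel_inter (E : nat -> family G) :
  (forall n, borel G (E n)) -> borel G (fun A => forall n, E n A).
Proof.
  intros HE; apply (borel_ext (fun A => ~ exists n, ~ E n A)).
  - intros A; split.
    + intros H n; apply NNPP; intros Hn; apply H; exists n; exact Hn.
    + intros H [n Hn]; exact (Hn (H n)).
  - apply borel_compl, borel_cunion; intros n; apply borel_compl, HE.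
Qed.

Lemma borel_const (P : Prop) : borel G (fun _ => P).
Proof. apply borel_open; intros A HA; exists nil; auto. Qed.

Lemma borel_union2 (E F : family G) :
  borel G E -> borel G F -> borel G (fun A => E A \/ F A).
Proof.
  intros HE HF.
  apply (borel_ext (fun A => exists n, (match n with O => E | _ => F end) A)).
  - intros A; split.
    + intros [[| n] H]; auto.
    + intros [H | H]; [exists 0 | exists 1]; exact H.
  - apply borel_cunion; intros [| n]; assumption.
Qed.

Lemma borel_preimage (f : PG G -> PG G) (E : family G) :
  (forall U, open2G G U -> open2G G (fun A => U (f A))) ->
  borel G E -> borel G (fun A => E (f A)).
Proof.
  intros Hf; induction 1 as [U HU | E _ IH | E _ IH].
  - apply borel_open, Hf, HU.
  - exact (borel_compl G _ IH).
  - exact (borel_cunion G _ IH).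
Qed.

Lemma open_preimage_sinter x y (U : family G) :
  open2G G U -> open2G G (fun A => U (sinter G (ltrans G x A) (ltrans G y A))).
Proof.
  intros HU A HA; destruct (HU _ HA) as [l Hl].
  exists (map (gmul G (inv x)) l ++ map (gmul G (inv y)) l); intros B HB.
  apply Hl; intros p Hp; unfold sinter, ltrans; f_equal; apply HB, in_or_app;
    [left | right]; apply in_map, Hp.
Qed.

Lemma open_exists_true (P : G -> Prop) : open2G G (fun A => exists p, P p /\ A p = true).
Proof.
  intros A [p [Hp HA]]; exists (p :: nil); intros B HB; exists p; split; [exact Hp|].
  rewrite HB; [exact HA | left; reflexivity].
Qed.

(** * Borel stages and countable ordinals over a countable group *)

Section Countable.
Variable e : G -> nat.
Hypothesis e_inj : forall x y, e x = e y -> x = y.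

(** A left inverse of [e], with an arbitrary value off the range of [e]. *)
Definition dec (n : nat) : G := epsilon (inhabits one) (fun x => e x = n).

Lemma decK x : dec (e x) = x.
Proof.
  apply e_inj; unfold dec; apply (epsilon_spec (inhabits one) (fun y => e y = e x)).
  exists x; reflexivity.
Qed.

(** Finiteness becomes boundedness of codes, so that infinitude turns into a countable intersection
    of open conditions. *)
Lemma finite_bounded A :
  finite_sets G A <-> exists n, forall p, A p = true -> e p < n.
Proof.
  split.
  - intros [l Hl].
    exists (S (list_max (map e l))); intros p Hp.
    apply Nat.lt_succ_r.
    pose proof (proj1 (list_max_le (map e l) _) (Nat.le_refl _)) as H.
    rewrite Forall_forall in H; apply H, in_map, Hl, Hp.
  - intros [n Hn]; exists (map dec (seq 0 n)); intros p Hp.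
    rewrite <- (decK p); apply in_map, in_seq; specialize (Hn p Hp); lia.
Qed.

Lemma infiniteP A :
  ~ finite_sets G A <-> forall n, exists p, n <= e p /\ A p = true.
Proof.
  rewrite finite_bounded; split.
  - intros H n; apply NNPP; intros Hn; apply H; exists n; intros p Hp.
    apply Nat.nle_gt; intros Hle; apply Hn; exists p; split; assumption.
  - intros H [n Hn]; destruct (H n) as [p [Hp HA]]; specialize (Hn p HA); lia.
Qed.

Lemma borel_finite : borel G (finite_sets G).
Proof.
  apply (borel_ext (fun A => ~ forall n, exists p, n <= e p /\ A p = true)).
  - intros A; rewrite <- infiniteP; split; [apply NNPP | tauto].
  - apply borel_compl, borel_inter; intros n; apply borel_open, open_exists_true.
Qed.

(** Every element has a code, so the condition over all pairs is a countable intersection of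
    preimages of [E] under continuous maps. *)
Lemma borel_tau (E : family G) : borel G E -> borel G (tau G E).
Proof.
  intros HE.
  apply (borel_ext (fun A => forall m n, dec m <> dec n ->
           E (sinter G (ltrans G (dec m) A) (ltrans G (dec n) A)))).
  - intros A; split; intros H; [|intros m n; apply H].
    intros x y; rewrite <- (decK x), <- (decK y); apply H.
  - apply borel_inter; intros m; apply borel_inter; intros n.
    destruct (classic (dec m = dec n)) as [Hmn | Hmn].
    + apply (borel_ext (fun _ => True)); [tauto | apply borel_const].
    + apply (borel_ext (fun A => E (sinter G (ltrans G (dec m) A) (ltrans G (dec n) A))));
        [tauto|].
      apply borel_preimage; [apply open_preimage_sinter | exact HE].
Qed.

Lemma borel_tau_iter (F : family G) a : borel G F -> borel G (tau_iter G F a).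
Proof.
  intros HF.
  assert (Hat : forall a, borel G (tau_lt G F a) -> borel G (tau_iter G F a)).
  { intros [| b | f] H; [exact HF | apply borel_tau, H | apply borel_tau, H]. }
  apply Hat; induction a as [| a IH | f IH]; simpl.
  - apply borel_const.
  - apply borel_union2; [exact IH | exact (Hat a IH)].
  - apply borel_cunion; intros n.
    apply borel_union2; [exact (IH n) | exact (Hat (f n) (IH n))].
Qed.

(** The union of the stages is itself a fixed point: the intersections of translates of one set
    involve only countably many stages, one per pair of codes, and a single [olim] bounds them. *)
Lemma tau_star_lt_omega1 A :
  tau_star G (finite_sets G) A <-> tau_lt_omega1 G (finite_sets G) A.
Proof.
  split.
  - intros H; apply H.
    + intros B HB; exists ozero; exact HB.
    + intros B; split.
      * intros HB.
        assert (Hf : forall p : nat * nat, exists a,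
                   dec (fst p) <> dec (snd p) ->
                   tau_iter G (finite_sets G) a
                     (sinter G (ltrans G (dec (fst p)) B) (ltrans G (dec (snd p)) B))).
        { intros p; destruct (classic (dec (fst p) = dec (snd p))) as [E | E].
          - exists ozero; tauto.
          - destruct (HB _ _ E) as [a Ha]; exists a; auto. }
        apply choice in Hf; destruct Hf as [f Hf].
        exists (olim (fun n => f (of_nat n))); intros x y Hxy; simpl.
        exists (to_nat (e x, e y)); right; rewrite cancel_of_to.
        rewrite <- (decK x), <- (decK y) in Hxy.
        specialize (Hf (e x, e y) Hxy); simpl in Hf; rewrite !decK in Hf; exact Hf.
      (* Stage zero is not of the form [tau], but finite sets have finite intersections of
         translates. *)
      * intros [a Ha] x y Hxy; destruct a as [| a | f]; unfold tau_iter, tau_at in Ha.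
        -- exists ozero; exact (finite_tau B Ha x y Hxy).
        -- exact (tau_lt_iter _ _ _ (Ha x y Hxy)).
        -- exact (tau_lt_iter _ _ _ (Ha x y Hxy)).
  - intros [a Ha] Phi HF Htau; revert Ha; apply tau_iter_sub_fixpoint; [exact HF|].
    intros B; apply Htau.
Qed.

End Countable.

End Group.

(** * Baire space *)

Definition baire := nat -> nat.

Definition agree (n : nat) (x y : baire) : Prop := forall i, i < n -> x i = y i.

Lemma agree_refl n x : agree n x x.
Proof. intros i _; reflexivity. Qed.

Lemma agree_sym n x y : agree n x y -> agree n y x.
Proof. intros H i Hi; symmetry; apply H, Hi. Qed.

Lemma agree_trans n x y z : agree n x y -> agree n y z -> agree n x z.
Proof. intros H K i Hi; rewrite (H i Hi); apply K, Hi. Qed.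

Lemma agree_le m n x y : m <= n -> agree n x y -> agree m x y.
Proof. intros H K i Hi; apply K; lia. Qed.

(** Codes prefixes by numbers: 0 is the empty prefix, and the successor keeps all other codes away
    from it, so a code determines the length. *)
Fixpoint pres (u : baire) (n : nat) : nat :=
  match n with O => O | S m => S (to_nat (pres u m, u m)) end.

Lemma pres_agree u v n : agree n u v -> pres u n = pres v n.
Proof.
  induction n as [| n IH]; intros H; [reflexivity|]; cbn [pres].
  rewrite IH, (H n) by (auto || intros i Hi; apply H; lia); reflexivity.
Qed.

Lemma pres_inj u v m n : pres u m = pres v n -> m = n /\ agree n u v.
Proof.
  revert n; induction m as [| m IH]; intros [| n]; cbn [pres]; try discriminate.
  - intros _; split; [reflexivity | intros i Hi; lia].
  - intros H; apply Nat.succ_inj, (f_equal of_nat) in H; rewrite !cancel_of_to in H.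
    injection H as H1 H2; destruct (IH _ H1) as [-> Ha]; split; [reflexivity|].
    intros i Hi; destruct (Nat.eq_dec i n) as [-> |]; [exact H2 | apply Ha; lia].
Qed.

Lemma pres_lt u n : pres u n < pres u (S n).
Proof. cbn [pres]; pose proof (to_nat_non_decreasing (pres u n) (u n)); lia. Qed.

Lemma pres_mono u m n : m < n -> pres u m < pres u n.
Proof.
  induction 1 as [| n _ IH]; [apply pres_lt|]; pose proof (pres_lt u n); lia.
Qed.

Definition locally_determined {G : Group} (f : baire -> PG G) : Prop :=
  forall x p, exists N, forall x', agree N x x' -> f x' p = f x p.

Lemma locally_determined_open G (f : baire -> PG G) U x :
  locally_determined f -> open2G G U -> U (f x) ->
  exists N, forall x', agree N x x' -> U (f x').
Proof.
  intros Hf HU Hx; destruct (HU _ Hx) as [l Hl].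
  assert (HN : exists N, forall x', agree N x x' -> forall p, In p l -> f x' p = f x p).
  { clear Hl; induction l as [| p l [N IH]]; [exists 0; intros z' _ p []|].
    destruct (Hf x p) as [M HM]; exists (Nat.max M N); intros z' Ha q [<- | Hq].
    - apply HM, agree_le with (2 := Ha); lia.
    - apply IH; [apply agree_le with (2 := Ha); lia | exact Hq]. }
  destruct HN as [N HN]; exists N; intros x' Ha; apply Hl, HN, Ha.
Qed.

Definition closed1 (C : baire -> Prop) : Prop :=
  forall z, (forall n, exists z', agree n z z' /\ C z') -> C z.

Definition first_diff (x y : baire) : nat :=
  epsilon (inhabits 0) (fun i => x i <> y i /\ agree i x y).

Lemma first_diffP x y :
  x <> y -> x (first_diff x y) <> y (first_diff x y) /\ agree (first_diff x y) x y.
Proof.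
  intros H; apply (epsilon_spec (inhabits 0) (fun i => x i <> y i /\ agree i x y)).
  assert (Hi : exists i, x i <> y i).
  { apply not_all_ex_not; intros Hi; apply H, functional_extensionality, Hi. }
  destruct Hi as [i Hi]; revert Hi; induction i as [i IH] using lt_wf_ind; intros Hi.
  destruct (classic (agree i x y)) as [Ha | Ha]; [exists i; split; assumption|].
  apply not_all_ex_not in Ha; destruct Ha as [j Hj].
  apply imply_to_and in Hj; destruct Hj as [Hj1 Hj2]; exact (IH j Hj1 Hj2).
Qed.

(** * Closed subsets of Baire space as Polish spaces *)

Section BaireDistance.
Local Open Scope R_scope.

Definition bdist (x y : baire) : R :=
  if excluded_middle_informative (x = y) then 0 else / INR (S (first_diff x y)).

Lemma inv_INR_pos n : 0 < / INR (S n).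
Proof. apply Rinv_0_lt_compat, lt_0_INR; lia. Qed.

Lemma inv_INR_le m n : (m <= n)%nat -> / INR (S n) <= / INR (S m).
Proof.
  intros H; apply Rinv_le_contravar; [apply lt_0_INR; lia | apply le_INR; lia].
Qed.

Lemma inv_INR_small eps : 0 < eps -> exists n, / INR (S n) < eps.
Proof.
  intros H; destruct (archimed_cor1 eps H) as [n [Hn Hp]]; exists n.
  apply Rle_lt_trans with (/ INR n); [|exact Hn].
  apply Rinv_le_contravar; [apply lt_0_INR; lia | apply le_INR; lia].
Qed.

(** Balls of radius 1/(n+1) are the cylinders fixing n+1 coordinates, so metric claims reduce to
    [agree]. *)
Lemma bdist_agree x y n : bdist x y < / INR (S n) <-> agree (S n) x y.
Proof.
  unfold bdist; destruct excluded_middle_informative as [-> | Hxy].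
  - split; intros _; [apply agree_refl | apply inv_INR_pos].
  - destruct (first_diffP x y Hxy) as [Hd Ha]; set (m := first_diff x y) in *; split.
    + intros H; apply agree_le with m; [|exact Ha].
      apply Nat.nlt_ge; intros Hm; pose proof (inv_INR_le m n); assert (m <= n)%nat by lia.
      specialize (H0 H1); lra.
    + intros H; apply Rle_lt_trans with (/ INR (S (S n))).
      * apply inv_INR_le, Nat.nlt_ge; intros Hm; apply Hd, H, Hm.
      * apply Rinv_lt_contravar; [apply Rmult_lt_0_compat; apply lt_0_INR; lia|].
        apply lt_INR; lia.
Qed.

Lemma bdist_nonneg x y : 0 <= bdist x y.
Proof.
  unfold bdist; destruct excluded_middle_informative; [lra|].
  left; apply inv_INR_pos.
Qed.

Lemma bdist_eq0 x y : bdist x y = 0 <-> x = y.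
Proof.
  unfold bdist; destruct excluded_middle_informative as [H | H]; [tauto|].
  pose proof (inv_INR_pos (first_diff x y)); split; [lra | tauto].
Qed.

Lemma bdist_ge x y i : x i <> y i -> / INR (S i) <= bdist x y.
Proof.
  intros H; apply Rnot_lt_le; intros Hlt; apply H.
  apply bdist_agree in Hlt; apply Hlt; lia.
Qed.

(** With [bdist_ge], this makes the distance the supremum of 1/(i+1) over all disagreements i;
    symmetry and the triangle inequality follow from that description. *)
Lemma bdist_le x y z : (forall i, x i <> y i -> / INR (S i) <= z) -> 0 <= z -> bdist x y <= z.
Proof.
  intros H Hz; unfold bdist; destruct excluded_middle_informative as [_ | Hxy]; [exact Hz|].
  apply H, first_diffP, Hxy.
Qed.

Lemma bdist_sym x y : bdist x y = bdist y x.
Proof.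
  apply Rle_antisym; apply bdist_le; try apply bdist_nonneg;
    intros i Hi; apply bdist_ge; auto.
Qed.

Lemma bdist_tri x y z : bdist x z <= bdist x y + bdist y z.
Proof.
  pose proof (bdist_nonneg x y); pose proof (bdist_nonneg y z).
  apply bdist_le; [|lra]; intros i Hi.
  destruct (Nat.eq_dec (x i) (y i)) as [E | E].
  - rewrite E in Hi; pose proof (bdist_ge _ _ _ Hi); lra.
  - pose proof (bdist_ge _ _ _ E); lra.
Qed.

Section ClosedSubspace.
Variable C : baire -> Prop.
Hypothesis C_closed : closed1 C.

Definition csub := {z : baire | C z}.
Definition cdist (x y : csub) : R := bdist (proj1_sig x) (proj1_sig y).

Lemma cdist_eq0 x y : cdist x y = 0 <-> x = y.
Proof.
  unfold cdist; rewrite bdist_eq0; split; [|intros ->; reflexivity].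
  destruct x as [x Hx], y as [y Hy]; simpl; intros ->.
  f_equal; apply proof_irrelevance.
Qed.

Lemma cdist_separable : exists s : nat -> option csub,
  forall x eps, 0 < eps -> exists n y, s n = Some y /\ cdist x y < eps.
Proof.
  (* Dense points are indexed by prefix codes: a prefix occurring in [C] receives some point of [C]
     extending it, any other number receives [None]. *)
  assert (H : forall n, exists o : option csub, forall (x : csub) k,
             n = pres (proj1_sig x) k ->
             exists y, o = Some y /\ agree k (proj1_sig x) (proj1_sig y)).
  { intros n; destruct (classic (exists (y : csub) k, n = pres (proj1_sig y) k))
      as [(y & k & Hy) | Hn].
    - exists (Some y); intros x j Hx; exists y; split; [reflexivity|].
      rewrite Hy in Hx; symmetry in Hx; apply pres_inj in Hx as [-> Ha]; exact Ha.
    - exists None; intros x k Hx; exfalso; apply Hn; exists x, k; exact Hx. }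
  apply choice in H; destruct H as [s Hs]; exists s; intros x eps Heps.
  destruct (inv_INR_small eps Heps) as [N HN].
  destruct (Hs _ x (S N) eq_refl) as [y [Hy Ha]].
  exists (pres (proj1_sig x) (S N)), y; split; [exact Hy|].
  apply Rlt_trans with (2 := HN); apply bdist_agree, Ha.
Qed.

Lemma cdist_complete : forall u : nat -> csub,
  (forall eps, 0 < eps -> exists N, forall m n, (m >= N)%nat -> (n >= N)%nat ->
     cdist (u m) (u n) < eps) ->
  exists l, forall eps, 0 < eps -> exists N, forall n, (n >= N)%nat -> cdist (u n) l < eps.
Proof.
  intros u Hu.
  assert (H : forall j, exists N, forall m n, (m >= N)%nat -> (n >= N)%nat ->
             proj1_sig (u m) j = proj1_sig (u n) j).
  { intros j; destruct (Hu _ (inv_INR_pos j)) as [N HN]; exists N; intros m n Hm Hn.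
    specialize (HN m n Hm Hn); apply bdist_agree in HN; apply HN; lia. }
  apply choice in H; destruct H as [N HN].
  (* Each coordinate is eventually constant along [u]; the limit reads it at a stage from which it
     is stable. *)
  pose (l := fun i => proj1_sig (u (N i)) i).
  assert (Hl : forall j, exists M, forall n, (n >= M)%nat -> agree j (proj1_sig (u n)) l).
  { intros j; induction j as [| j [M IH]]; [exists O; intros n _ i Hi; lia|].
    exists (Nat.max M (N j)); intros n Hn i Hi; destruct (Nat.eq_dec i j) as [-> | E].
    - apply HN; lia.
    - apply IH; lia. }
  assert (HC : C l).
  { apply C_closed; intros n; destruct (Hl n) as [M HM].
    exists (proj1_sig (u M)); split; [apply agree_sym, HM; lia | apply proj2_sig]. }
  exists (exist _ l HC); intros eps Heps; destruct (inv_INR_small eps Heps) as [n Hn].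
  destruct (Hl (S n)) as [M HM]; exists M; intros m Hm.
  apply Rlt_trans with (2 := Hn); apply bdist_agree, HM, Hm.
Qed.

Definition closed_polish : polish_space :=
  {| pcar := csub; pd := cdist;
     pd_nonneg := fun x y => bdist_nonneg _ _;
     pd_eq0 := cdist_eq0;
     pd_sym := fun x y => bdist_sym _ _;
     pd_tri := fun x y z => bdist_tri _ _ _;
     p_separable := cdist_separable;
     p_complete := cdist_complete |}.

Lemma analytic_closed_image (G : Group) (f : baire -> PG G) :
  locally_determined f ->
  analytic G (fun A => exists z, C z /\ f z = A).
Proof.
  intros Hf; exists closed_polish, (fun z => f (proj1_sig z)); split.
  - intros U HU [z Hz] Hx; simpl in Hx |- *.
    destruct (locally_determined_open G f U z Hf HU Hx) as [N HN].
    exists (/ INR (S N)); split; [apply inv_INR_pos|].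
    intros [y Hy] Hd; apply HN; apply bdist_agree in Hd; simpl in Hd |- *.
    apply agree_le with (2 := Hd); lia.
  - intros A; split.
    + intros [z [Hz E]]; exists (exist _ z Hz); exact E.
    + intros [[z Hz] E]; exists z; split; assumption.
Qed.

End ClosedSubspace.
End BaireDistance.

(** * Coanalyticity of the thin-completion *)

Section Coanalytic.
Variables (G : Group) (e : G -> nat).
Hypothesis e_inj : forall x y, e x = e y -> x = y.

(* A point [z] codes a set, a sequence of shifts, and unboundedness witnesses for the
   iterated intersections. *)
Let zset (z : baire) : PG G := fun p => negb (Nat.eqb (z (to_nat (0, e p))) 0).
Let zshift (z : baire) (n : nat) : G := dec G e (z (to_nat (1, n))).
Let zwit (z : baire) (n m : nat) : G := dec G e (z (to_nat (2, to_nat (n, m)))).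

Let zC (z : baire) : Prop := forall n, zshift z n <> gone G /\
  forall m, m <= e (zwit z n m) /\ der G (zshift z) (zset z) n (zwit z n m) = true.

(** Each step evaluates one shift and the previous intersection at two points, so only finitely many
    coordinates of [z] matter. *)
Lemma der_local z n p : exists N, forall z', agree N z z' ->
  der G (zshift z') (zset z') n p = der G (zshift z) (zset z) n p.
Proof.
  revert p; induction n as [| n IH]; intros p.
  - exists (S (to_nat (0, e p))); intros z' H; cbn [der]; unfold zset.
    rewrite (H (to_nat (0, e p))) by lia; reflexivity.
  - destruct (IH p) as [N1 H1], (IH (gmul G (ginv G (zshift z n)) p)) as [N2 H2].
    exists (Nat.max (S (to_nat (1, n))) (Nat.max N1 N2)); intros z' H; cbn [der].
    assert (E : zshift z' n = zshift z n).
    { unfold zshift; rewrite (H (to_nat (1, n))) by lia; reflexivity. }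
    unfold capshift, sinter, ltrans; rewrite E, H1, H2;
      try reflexivity; apply agree_le with (2 := H); lia.
Qed.

(** As the unboundedness witnesses are part of [z], every clause of [zC] inspects finitely many
    coordinates and passes to limits. *)
Lemma zC_closed : closed1 zC.
Proof.
  intros z Hz n; split.
  - destruct (Hz (S (to_nat (1, n)))) as [z' [Ha HC]].
    unfold zshift; rewrite (Ha (to_nat (1, n))) by lia; apply HC.
  - intros m; destruct (der_local z n (zwit z n m)) as [N HN].
    destruct (Hz (Nat.max N (S (to_nat (2, to_nat (n, m)))))) as [z' [Ha HC]].
    assert (E : zwit z' n m = zwit z n m).
    { unfold zwit; rewrite (Ha (to_nat (2, to_nat (n, m)))) by lia; reflexivity. }
    destruct (HC n) as [_ Hm]; specialize (Hm m); rewrite E in Hm.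
    rewrite HN in Hm by (apply agree_le with (2 := Ha); lia); exact Hm.
Qed.

Lemma coanalytic_tau_star : coanalytic G (tau_star G (finite_sets G)).
Proof.
  unfold coanalytic.
  replace (fun A => ~ tau_star G (finite_sets G) A)
    with (fun A => exists z, zC z /\ zset z = A).
  { apply analytic_closed_image; [apply zC_closed|]; intros z p.
    exact (der_local z 0 p). }
  apply functional_extensionality; intros A; apply propositional_extensionality.
  rewrite tau_starP, not_thin_wfP; split.
  - intros [z [Hz <-]]; exists (zshift z); split; [intros n; apply Hz|].
    intros n; apply (infiniteP G e e_inj); intros m.
    exists (zwit z n m); apply Hz.
  - intros (k & Hk & Hd).
    assert (Hw : forall q : nat * nat, exists p,
               snd q <= e p /\ der G k A (fst q) p = true).
    { intros [n m]; exact (proj1 (infiniteP G e e_inj _) (Hd n) m). }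
    apply choice in Hw; destruct Hw as [w Hw].
    (* Tags 0, 1, 2 carry the set, the shifts and the witnesses; the last branch serves tag 2. *)
    pose (z := fun i => match of_nat i with
      | (0, m) => if A (dec G e m) then 1 else 0
      | (1, n) => e (k n)
      | (_, q) => e (w (of_nat q)) end).
    assert (HA : zset z = A).
    { apply functional_extensionality; intros p; unfold zset, z.
      rewrite cancel_of_to, decK by exact e_inj; destruct (A p); reflexivity. }
    assert (Hs : zshift z = k).
    { apply functional_extensionality; intros n; unfold zshift, z.
      rewrite cancel_of_to; apply decK, e_inj. }
    exists z; split; [|exact HA]; intros n; rewrite HA, Hs; split; [apply Hk|].
    intros m.
    assert (E : zwit z n m = w (n, m)).
    { unfold zwit, z; rewrite cancel_of_to, cancel_of_to; apply decK, e_inj. }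
    rewrite E; exact (Hw (n, m)).
Qed.

End Coanalytic.

(** * Analytic sets of Baire space *)

Lemma exists_bound (F : nat -> nat) m : exists N, m <= N /\ forall i, i < m -> F i < N.
Proof.
  induction m as [| m [N [IH1 IH2]]]; [exists 0; split; [lia | intros i Hi; lia]|].
  exists (S (Nat.max N (F m))); split; [lia|]; intros i Hi.
  destruct (Nat.eq_dec i m) as [-> |]; [lia|]; specialize (IH2 i); lia.
Qed.

Definition closed2 (C : baire -> baire -> Prop) : Prop :=
  forall x u, (forall n, exists x' u', agree n x x' /\ agree n u u' /\ C x' u') -> C x u.

(** Analytic subsets of Baire space, in the form of projections of closed sets. *)
Definition sigma11 (Q : baire -> Prop) : Prop :=
  exists C, closed2 C /\ forall x, Q x <-> exists u, C x u.

(* [c] codes the closed set of pairs all of whose prefixes are zeros of [c]; read with [x]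
   fixed, it codes a tree whose infinite branches are the [u] with [branch c x u]. *)
Definition branch (c x u : baire) : Prop :=
  forall n, c (to_nat (pres x n, pres u n)) = 0.

(** The code marks with 0 the pairs of equally long prefixes that extend to a point of [C];
    closedness puts a pair with all prefixes marked into [C]. *)
Lemma closed2_code (C : baire -> baire -> Prop) :
  closed2 C -> exists c, forall x u, C x u <-> branch c x u.
Proof.
  intros HC.
  exists (fun i => if pbool (exists x u n, C x u /\ of_nat i = (pres x n, pres u n))
                   then 0 else 1).
  intros x u; split.
  - intros H n; rewrite cancel_of_to.
    replace (pbool _) with true; [reflexivity|]; symmetry; apply pboolP.
    exists x, u, n; split; [exact H | reflexivity].
  - intros H; apply HC; intros n; specialize (H n); cbn beta in H.
    rewrite cancel_of_to in H.
    destruct (pbool _) eqn:E in H; [|discriminate]; apply (proj1 (pboolP _)) in E.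
    destruct E as (x' & u' & m & H' & Ex); injection Ex as E1 E2.
    exists x', u'; apply pres_inj in E1 as [<- E1]; apply pres_inj in E2 as [_ E2].
    auto.
Qed.

(** Cantor's diagonal: a closed set with this projection would have a code [c], and at [c] a
    statement becomes equivalent to its negation. *)
Lemma sigma11_diagonal : ~ sigma11 (fun c => ~ exists u, branch c c u).
Proof.
  intros (C & HC & HQ); destruct (closed2_code C HC) as [c Hc].
  assert (H : (exists u, C c u) <-> exists u, branch c c u).
  { split; intros [u Hu]; exists u; apply Hc, Hu. }
  specialize (HQ c); tauto.
Qed.

Lemma sigma11_ext (P Q : baire -> Prop) : (forall x, P x <-> Q x) -> sigma11 P -> sigma11 Q.
Proof. intros H (C & HC & HP); exists C; split; [exact HC|]; intros x; rewrite <- H; auto. Qed.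

Lemma sigma11_union (Q : nat -> baire -> Prop) :
  (forall n, sigma11 (Q n)) -> sigma11 (fun x => exists n, Q n x).
Proof.
  intros HQ; apply choice in HQ; destruct HQ as [C HC].
  exists (fun x u => C (u 0) x (fun i => u (S i))); split.
  - intros x u H; apply HC; intros n; destruct (H (S n)) as (x' & u' & Hx & Hu & H').
    exists x', (fun i => u' (S i)); split; [apply agree_le with (2 := Hx); lia|]; split.
    + intros i Hi; apply Hu; lia.
    + rewrite (Hu 0) by lia; exact H'.
  - intros x; split.
    + intros [n Hn]; apply HC in Hn; destruct Hn as [u Hu].
      exists (fun i => match i with 0 => n | S j => u j end); exact Hu.
    + intros [u Hu]; exists (u 0); apply HC; exists (fun i => u (S i)); exact Hu.
Qed.

(** One sequence interleaves, through pairing, a witness for every member of the family. *)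
Lemma sigma11_inter (Q : nat -> baire -> Prop) :
  (forall n, sigma11 (Q n)) -> sigma11 (fun x => forall n, Q n x).
Proof.
  intros HQ; apply choice in HQ; destruct HQ as [C HC].
  exists (fun x u => forall n, C n x (fun i => u (to_nat (n, i)))); split.
  - intros x u H n; apply HC; intros m.
    destruct (exists_bound (fun i => to_nat (n, i)) m) as [N [HmN HN]].
    destruct (H N) as (x' & u' & Hx & Hu & H').
    exists x', (fun i => u' (to_nat (n, i))); split; [apply agree_le with (2 := Hx); lia|].
    split; [|apply H']; intros i Hi; apply Hu, HN, Hi.
  - intros x; split.
    + intros H.
      assert (Hu : forall n, exists u, C n x u) by (intros n; apply HC, H).
      apply choice in Hu; destruct Hu as [u Hu].
      exists (fun i => let (n, j) := of_nat i in u n j); intros n.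
      assert (En : (fun i => let (n, j) := of_nat (to_nat (n, i)) in u n j) = u n).
      { apply functional_extensionality; intros i; rewrite cancel_of_to; reflexivity. }
      rewrite En; apply Hu.
    + intros [u Hu] n; apply HC; eexists; apply Hu.
Qed.

(** * Pullbacks of Borel and analytic families to Baire space *)

Section Pullback.
Variables (G : Group) (psi : baire -> PG G).
Hypothesis psi_local : locally_determined psi.

(** The complement is carried along because [borel_compl] exchanges the two halves. *)
Lemma borel_sigma11 (E : family G) :
  borel G E -> sigma11 (fun x => E (psi x)) /\ sigma11 (fun x => ~ E (psi x)).
Proof.
  induction 1 as [U HU | E _ IH | E _ IH].
  - split.
    (* Here [u 0] is the length of a prefix of [x] whose whole cylinder is mapped into [U]. *)
    + exists (fun x u => forall x', agree (u 0) x x' -> U (psi x')); split.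
      * intros x u H x' Hx'.
        destruct (H (S (u 0))) as (y & v & Hx & Hu & Hy).
        apply Hy; rewrite <- (Hu 0) by lia; apply agree_trans with x; [|exact Hx'].
        apply agree_sym, agree_le with (2 := Hx); lia.
      * intros x; split.
        -- intros Hx; destruct (locally_determined_open G psi U x psi_local HU Hx) as [N HN].
           exists (fun _ => N); exact HN.
        -- intros [u Hu]; apply Hu, agree_refl.
    + exists (fun x _ => ~ U (psi x)); split.
      * intros x u H Hx; destruct (locally_determined_open G psi U x psi_local HU Hx) as [N HN].
        destruct (H N) as (x' & _ & Ha & _ & Hx'); exact (Hx' (HN x' Ha)).
      * intros x; split; [intros H; exists x; exact H | intros [_ H]; exact H].
  - destruct IH as [IH1 IH2]; split; [exact IH2|].
    apply (sigma11_ext (fun x => E (psi x))); [|exact IH1].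
    intros x; split; [tauto | apply NNPP].
  - split; [exact (sigma11_union _ (fun n => proj1 (IH n)))|].
    apply (sigma11_ext (fun x => forall n, ~ E n (psi x)));
      [|exact (sigma11_inter _ (fun n => proj2 (IH n)))].
    intros x; split; [intros H [n Hn]; exact (H n Hn)|].
    intros H n Hn; apply H; exists n; exact Hn.
Qed.

Lemma analytic_sigma11 (E : family G) : analytic G E -> sigma11 (fun x => E (psi x)).
Proof.
  intros (X & f & Hf & HE); destruct (p_separable X) as [s Hs].
  (* [u] names a point [p] through indices of dense points at distance at most 1/(n+1). *)
  exists (fun x u => exists p : X,
    (forall n, exists y, s (u n) = Some y /\ (pd X p y <= / INR (S n))%R) /\ f p = psi x).
  split.
  - intros x u H.
    assert (Hy : forall n, exists y, s (u n) = Some y).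
    { intros n; destruct (H (S n)) as (x' & u' & _ & Hu & p & Hp & _).
      destruct (Hp n) as [y [Hy _]]; exists y; rewrite (Hu n) by lia; exact Hy. }
    apply choice in Hy; destruct Hy as [y Hy].
    (* Each finite stage is realised by a point [p'] close to the first [N] named dense points;
       these varying points show that [y] is Cauchy. *)
    assert (Hd : forall N, exists x' (p' : X), agree N x x' /\ f p' = psi x' /\
               forall n, n < N -> (pd X p' (y n) <= / INR (S n))%R).
    { intros N; destruct (H N) as (x' & u' & Hx & Hu & p & Hp & E').
      exists x', p; split; [exact Hx|]; split; [exact E'|]; intros n Hn.
      destruct (Hp n) as [y' [Hy' Hle]]; rewrite <- (Hu n Hn), Hy in Hy'.
      injection Hy' as ->; exact Hle. }
    destruct (p_complete X y) as [p Hp].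
    { intros eps Heps; destruct (inv_INR_small (eps / 2)) as [N HN]; [lra|].
      exists N; intros m n Hm Hn.
      destruct (Hd (S (Nat.max m n))) as (_ & p' & _ & _ & Hp').
      pose proof (Hp' m ltac:(lia)); pose proof (Hp' n ltac:(lia)).
      pose proof (inv_INR_le N m Hm); pose proof (inv_INR_le N n Hn).
      pose proof (pd_tri X (y m) p' (y n)); pose proof (pd_sym X (y m) p'); lra. }
    assert (Hpy : forall n, (pd X p (y n) <= / INR (S n))%R).
    { intros n; apply Rnot_lt_le; intros Hlt.
      pose (eps := ((pd X p (y n) - / INR (S n)) / 2)%R).
      assert (Heps : (0 < eps)%R) by (unfold eps; lra).
      destruct (Hp _ Heps) as [N HN], (inv_INR_small _ Heps) as [M HM].
      destruct (Hd (S (Nat.max n (Nat.max N M)))) as (_ & p' & _ & _ & Hp').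
      pose (m := Nat.max N M).
      pose proof (HN m ltac:(lia)); pose proof (Hp' m ltac:(lia)).
      pose proof (Hp' n ltac:(lia)); pose proof (inv_INR_le M m ltac:(lia)).
      pose proof (pd_tri X p (y m) (y n)); pose proof (pd_tri X (y m) p' (y n)).
      pose proof (pd_sym X p (y m)); pose proof (pd_sym X (y m) p'); unfold eps in *; lra. }
    exists p; split; [intros n; exists (y n); split; [apply Hy | apply Hpy]|].
    (* Continuity is tested at one element [g]: near [p] the map [f] keeps its bit at [g], and a
       late [p'] has an image [psi x'] agreeing with [psi x] there. *)
    apply functional_extensionality; intros g.
    destruct (psi_local x g) as [N HN].
    destruct (Hf (fun A => A g = f p g)) with (x := p) as [eps [Heps Hball]];
      [|reflexivity|].
    { intros A HA; exists (g :: nil); intros B HB; rewrite HB; [exact HA | left; reflexivity]. }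
    destruct (inv_INR_small (eps / 2)) as [M HM]; [lra|].
    destruct (Hd (S (Nat.max N M))) as (x' & p' & Ha & Ep & Hp').
    rewrite <- (HN x') by (apply agree_le with (2 := Ha); lia).
    rewrite <- Ep; symmetry; apply Hball.
    pose proof (Hp' M ltac:(lia)); pose proof (Hpy M); pose proof (pd_tri X p (y M) p').
    pose proof (pd_sym X (y M) p'); lra.
  - intros x; rewrite HE; split.
    + intros [p Ep].
      assert (Hu : forall n, exists i y, s i = Some y /\ (pd X p y <= / INR (S n))%R).
      { intros n; destruct (Hs p _ (inv_INR_pos n)) as (i & y & Hi & Hlt).
        exists i, y; split; [exact Hi | lra]. }
      apply choice in Hu; destruct Hu as [u Hu]; exists u, p; split; assumption.
    + intros (u & p & _ & Ep); exists p; exact Ep.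
Qed.

End Pullback.

(** * Base four expansions *)

Fixpoint val (f : nat -> bool) (K : nat) : nat :=
  match K with O => O | S k => val f k + (if f k then 4 ^ k else 0) end.

Definition supp (f : nat -> bool) (K : nat) : Prop := forall k, f k = true -> k < K.

(** A geometric series; the factor 3 leaves room for recovering the leading digit of a
    difference. *)
Lemma val_lt f K : 3 * val f K < 4 ^ K.
Proof.
  induction K as [| K IH]; [simpl; lia|]; cbn [val]; rewrite Nat.pow_succ_r'.
  destruct (f K); lia.
Qed.

Lemma val_supp f K K' : supp f K -> K <= K' -> val f K' = val f K.
Proof.
  intros Hf; induction 1 as [| K' H IH]; [reflexivity|]; cbn [val]; rewrite IH.
  destruct (f K') eqn:E; [|lia]; apply Hf in E; lia.
Qed.

Lemma val_bit f K k : f k = true -> k < K -> 4 ^ k <= val f K.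
Proof.
  intros Hk; induction 1 as [| K H IH]; cbn [val]; [rewrite Hk; lia | lia].
Qed.

Lemma val_add f q K : f q = false ->
  val (fun k => orb (Nat.eqb k q) (f k)) K = val f K + (if q <? K then 4 ^ q else 0).
Proof.
  intros Hq; induction K as [| K IH]; [reflexivity|]; cbn [val]; rewrite IH.
  destruct (Nat.eqb_spec K q) as [-> | E]; cbn [orb].
  - rewrite Hq, Nat.ltb_irrefl; destruct (Nat.ltb_spec q (S q)); lia.
  - destruct (Nat.ltb_spec q K), (Nat.ltb_spec q (S K)), (f K); lia.
Qed.

(** The range left for d when a leading term 4^s, of either sign, is perturbed by less than a third
    of it. The ranges for different exponents are disjoint. *)
Definition top (d : Z) (s : nat) : Prop :=
  (2 * Z.of_nat (4 ^ s) < 3 * Z.abs d < 4 * Z.of_nat (4 ^ s))%Z.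

Lemma top_unique d s t : top d s -> top d t -> s = t.
Proof.
  assert (H : forall s t, s < t -> top d s -> top d t -> False).
  { clear; unfold top; intros s t Hst Hs Ht.
    assert (4 ^ S s <= 4 ^ t) by (apply Nat.pow_le_mono_r; lia).
    rewrite Nat.pow_succ_r' in H; generalize dependent (4 ^ s); generalize dependent (4 ^ t).
    lia. }
  intros Hs Ht; destruct (lt_eq_lt_dec s t) as [[E | E] | E]; [|exact E|];
    exfalso; eauto.
Qed.

(* The leading disagreement of two sets of exponents is read off the difference of their
   values, since the lower digits contribute less than a third of it. *)
Lemma val_sub_top f f' K d :
  (Z.of_nat (val f K) - Z.of_nat (val f' K) = d)%Z -> d <> 0%Z ->
  exists s, s < K /\ top d s /\ f s = (0 <? d)%Z /\ f' s = negb (f s) /\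
    forall k, s < k < K -> f k = f' k.
Proof.
  induction K as [| K IH]; cbn [val]; [simpl; lia|]; intros Hd H0.
  pose proof (val_lt f K) as L; pose proof (val_lt f' K) as L'.
  destruct (Bool.bool_dec (f K) (f' K)) as [E | E].
  - destruct IH as (s & Hs & Ht & H1 & H2 & H3); [rewrite E in Hd; lia | exact H0 |].
    exists s; repeat split; try assumption; try apply Ht; [lia|]; intros k Hk.
    destruct (Nat.eq_dec k K) as [-> |]; [exact E | apply H3; lia].
  - exists K; split; [lia|]; unfold top; generalize dependent (4 ^ K); intros P Hd L L'.
    destruct (f K), (f' K); try congruence.
    + destruct (Z.ltb_spec 0 d); repeat split; try lia; intros k Hk; lia.
    + destruct (Z.ltb_spec 0 d); repeat split; try lia; intros k Hk; lia.
Qed.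

(** * Chains in the tree of a code *)

(** Comparability of nodes, phrased by a common extension to be symmetric; taking [k = l] expresses
    being a node. *)
Definition comp (c : baire) (k l : nat) : Prop :=
  exists u n m, k = pres u n /\ l = pres u m /\
    forall j, j <= n \/ j <= m -> c (to_nat (pres c j, pres u j)) = 0.

Lemma comp_sym c k l : comp c k l -> comp c l k.
Proof.
  intros (u & n & m & Hk & Hl & H); exists u, m, n; repeat split; auto.
  intros j; rewrite or_comm; auto.
Qed.

(** The codes fix both prefixes, so finitely many values of [c] are consulted, at positions
    depending on a prefix of [c] itself. *)
Lemma comp_local c k l :
  exists N, forall c', agree N c c' -> (comp c' k l <-> comp c k l).
Proof.
  destruct (classic (exists u n m, k = pres u n /\ l = pres u m))
    as [(u & n & m & Hk & Hl) | Hn].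
  2: { exists 0; intros c' _; split; intros (u & n & m & Hk & Hl & _); exfalso;
       apply Hn; exists u, n, m; auto. }
  assert (HP : forall c, comp c k l <->
            forall j, j <= n \/ j <= m -> c (to_nat (pres c j, pres u j)) = 0).
  { clear c; intros c; split; [|intros H; exists u, n, m; auto].
    intros (u' & n' & m' & Hk' & Hl' & H) j Hj.
    rewrite Hk in Hk'; rewrite Hl in Hl'.
    apply pres_inj in Hk' as [<- Hk'], Hl' as [<- Hl'].
    rewrite (pres_agree u u' j); [apply H, Hj|].
    destruct Hj as [Hj | Hj]; eapply agree_le; eauto. }
  destruct (exists_bound (fun j => to_nat (pres c j, pres u j)) (S (Nat.max n m)))
    as [N [HN1 HN2]].
  exists N; intros c' Ha; rewrite !HP.
  assert (E : forall j, j <= n \/ j <= m ->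
            c' (to_nat (pres c' j, pres u j)) = c (to_nat (pres c j, pres u j))).
  { intros j Hj; rewrite <- (pres_agree c c' j) by (apply agree_le with (2 := Ha); lia).
    symmetry; apply Ha, HN2; lia. }
  split; intros H j Hj; specialize (H j Hj); rewrite E in *; auto.
Qed.

Lemma agree_forall_lt (c : baire) (P : nat -> baire -> Prop) :
  (forall k, exists N, forall c', agree N c c' -> P k c') ->
  forall n, exists N, forall c', agree N c c' -> forall k, k < n -> P k c'.
Proof.
  intros H; apply choice in H; destruct H as [F HF]; intros n.
  destruct (exists_bound F n) as [N [_ HN]]; exists N; intros c' Ha k Hk.
  apply HF; apply agree_le with (2 := Ha); specialize (HN k Hk); lia.
Qed.

(** Distinct comparable nodes differ in length, so the lengths are unbounded and the nodes glue
    together to a branch. *)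
Lemma comp_sequence_branch c (s : nat -> nat) :
  (forall i j, i < j -> s i <> s j /\ comp c (s i) (s j)) -> exists u, branch c c u.
Proof.
  intros Hs.
  assert (Hc : forall i j, i <> j -> comp c (s i) (s j)).
  { intros i j H; destruct (Nat.lt_gt_cases i j) as [H' _].
    destruct (H' H) as [E | E]; [|apply comp_sym]; apply Hs, E. }
  assert (Hinj : forall i j, s i = s j -> i = j).
  { intros i j E; destruct (lt_eq_lt_dec i j) as [[H | H] | H]; [|exact H|];
      exfalso; destruct (Hs _ _ H); auto. }
  assert (Hv : forall i, exists p : baire * nat, s i = pres (fst p) (snd p) /\
             forall j, j <= snd p -> c (to_nat (pres c j, pres (fst p) j)) = 0).
  { intros i; destruct (Hc i (S i)) as (u & n & m & Hn & _ & H); [lia|].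
    exists (u, n); split; [exact Hn | intros j Hj; apply H; left; exact Hj]. }
  apply choice in Hv; destruct Hv as [w Hw].
  pose (v := fun i => fst (w i)); pose (n := fun i => snd (w i)).
  assert (Hpair : forall i j, i <> j ->
             n i <> n j /\ forall x, x < n i -> x < n j -> v i x = v j x).
  { intros i j Hij; destruct (Hc i j Hij) as (u & a & b & Ha & Hb & _).
    destruct (Hw i) as [Hi _], (Hw j) as [Hj _].
    pose proof Ha as Ha'; pose proof Hb as Hb'.
    rewrite Hi in Ha'; rewrite Hj in Hb'.
    apply pres_inj in Ha' as [Ea Aa], Hb' as [Eb Ab]; split.
    - intros E; apply Hij, Hinj; rewrite Ha, Hb, <- Ea, <- Eb; f_equal; exact E.
    - intros x Hxi Hxj; unfold v; rewrite Aa, Ab; auto; [rewrite <- Eb | rewrite <- Ea]; auto. }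
  assert (Hunb : forall m, exists i, m <= n i).
  { apply injective_unbounded; intros i j E; apply NNPP; intros Hij.
    exact (proj1 (Hpair i j Hij) E). }
  apply choice in Hunb; destruct Hunb as [I HI].
  (* Coordinate x comes from a node of length at least x+1; comparability makes the choice of node
     immaterial. *)
  pose (u := fun x => v (I (S x)) x); exists u; intros m.
  rewrite (pres_agree u (v (I m)) m); [apply Hw, HI|].
  intros x Hx; unfold u; destruct (Nat.eq_dec (I (S x)) (I m)) as [-> | E]; [reflexivity|].
  apply Hpair; [exact E | apply HI | specialize (HI m); lia].
Qed.

Definition chain_sum (c : baire) (N : nat) : Prop :=
  exists f K, supp f K /\ N = val f K /\
    forall k l, f k = true -> f l = true -> comp c k l.

(** An exponent k of [N] satisfies k < 4^k and 4^k is at most [N], so finitely many pairs of nodes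
    matter. *)
Lemma chain_sum_local c N :
  exists M, forall c', agree M c c' -> (chain_sum c' N <-> chain_sum c N).
Proof.
  destruct (agree_forall_lt c
    (fun k c' => forall l, l < S N -> (comp c' k l <-> comp c k l))) with (n := S N)
    as [M HM].
  { intros k; apply agree_forall_lt; intros l; apply comp_local. }
  exists M; intros c' Ha; specialize (HM c' Ha).
  assert (Hb : forall f K k, supp f K -> N = val f K -> f k = true -> k < S N).
  { intros f K k Hf -> Hk; pose proof (val_bit f K k Hk (Hf k Hk)).
    pose proof (Nat.pow_gt_lin_r 4 k); lia. }
  split; intros (f & K & Hf & E & H); exists f, K; repeat split; auto;
    intros k l Hk Hl; apply HM; eauto.
Qed.

(** The four numbers are the corners of a parallelogram with sides a and b; some corner has both
    leading exponents s and t among its digits, and its chain makes them comparable. *)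
Lemma chain_sum_square c (a b : Z) (s t N N1 N2 N3 : nat) :
  chain_sum c N -> chain_sum c N1 -> chain_sum c N2 -> chain_sum c N3 ->
  (Z.of_nat N - Z.of_nat N1 = a)%Z -> (Z.of_nat N - Z.of_nat N2 = b)%Z ->
  (Z.of_nat N1 - Z.of_nat N3 = b)%Z -> (Z.of_nat N2 - Z.of_nat N3 = a)%Z ->
  a <> 0%Z -> b <> 0%Z -> top a s -> top b t -> s <> t /\ comp c s t.
Proof.
  intros (f & K & Sf & -> & Cf) (f1 & K1 & Sf1 & -> & Cf1) (f2 & K2 & Sf2 & -> & Cf2)
    (f3 & K3 & Sf3 & -> & Cf3) E1 E2 E3 E4 Ha Hb Ts Tt.
  pose (L := Nat.max (Nat.max K K1) (Nat.max K2 K3)).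
  rewrite <- (val_supp f K L), <- (val_supp f1 K1 L) in E1 by (assumption || lia).
  rewrite <- (val_supp f K L), <- (val_supp f2 K2 L) in E2 by (assumption || lia).
  rewrite <- (val_supp f1 K1 L), <- (val_supp f3 K3 L) in E3 by (assumption || lia).
  rewrite <- (val_supp f2 K2 L), <- (val_supp f3 K3 L) in E4 by (assumption || lia).
  destruct (val_sub_top _ _ _ _ E1 Ha) as (s1 & L1 & T1 & A1 & B1 & C1).
  destruct (val_sub_top _ _ _ _ E2 Hb) as (s2 & L2 & T2 & A2 & B2 & C2).
  destruct (val_sub_top _ _ _ _ E3 Hb) as (s3 & L3 & T3 & A3 & B3 & C3).
  destruct (val_sub_top _ _ _ _ E4 Ha) as (s4 & L4 & T4 & A4 & B4 & C4).
  rewrite (top_unique _ _ _ T1 Ts) in *; rewrite (top_unique _ _ _ T2 Tt) in *.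
  rewrite (top_unique _ _ _ T3 Tt) in *; rewrite (top_unique _ _ _ T4 Ts) in *.
  (* If s = t, the sign of b dictates this digit at both [N] and [N1], while the side a between them
     flips it. *)
  assert (Hst : s <> t).
  { intros <-; rewrite A1 in A2; rewrite A1 in B1; rewrite A3 in B1.
    rewrite A2 in B1; destruct (0 <? b)%Z; discriminate. }
  split; [exact Hst|].
  destruct (Nat.lt_gt_cases s t) as [Hlt _]; destruct (Hlt Hst) as [H | H].
  (* Digit t lies above s, so both sides of difference a preserve it. It is present along one of
     them, and one end of that side contains s. The other case exchanges the roles. *)
  - specialize (C1 t ltac:(lia)); specialize (C4 t ltac:(lia)).
    destruct (f t) eqn:Et, (f s) eqn:Es, (f2 s) eqn:Es2; cbn [negb] in *;
      try (apply Cf; congruence); try (apply Cf1; congruence);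
      try (apply Cf2; congruence); apply Cf3; congruence.
  - specialize (C2 s ltac:(lia)); specialize (C3 s ltac:(lia)).
    destruct (f s) eqn:Es, (f t) eqn:Et, (f1 t) eqn:Et1; cbn [negb] in *;
      try (apply Cf; congruence); try (apply Cf1; congruence);
      try (apply Cf2; congruence); apply Cf3; congruence.
Qed.

(** * Reduction of well-founded trees to the thin-completion *)

Section Reduction.
Variables (G : Group) (g : G).
Hypothesis g_inf : infinite_order G g.

Lemma gpow_add m n : gpow G g (m + n) = gmul G (gpow G g m) (gpow G g n).
Proof.
  induction m as [| m IH]; simpl; [rewrite gmul_1l; reflexivity|].
  rewrite IH, gmul_assoc; reflexivity.
Qed.

Lemma gpow_inj m n : gpow G g m = gpow G g n -> m = n.
Proof.
  assert (H : forall m n, m < n -> gpow G g m <> gpow G g n).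
  { clear m n; intros m n Hmn E; apply (g_inf (n - m)); [lia|].
    apply (gmul_cancel_l G (gpow G g m)).
    rewrite <- gpow_add, gmul_1r; replace (m + (n - m)) with n by lia; auto. }
  intros E; destruct (lt_eq_lt_dec m n) as [[L | L] | L]; [|exact L|];
    exfalso; eapply H; eauto.
Qed.

Definition psi (c : baire) : PG G :=
  fun p => pbool (exists N, p = gpow G g N /\ chain_sum c N).

Lemma psiP c p : psi c p = true <-> exists N, p = gpow G g N /\ chain_sum c N.
Proof. apply pboolP. Qed.

Lemma psi_local : locally_determined psi.
Proof.
  intros c p.
  destruct (classic (exists N, p = gpow G g N)) as [[N ->] | Hn].
  - destruct (chain_sum_local c N) as [M HM]; exists M; intros c' Ha; apply pbool_iff.
    specialize (HM c' Ha).
    split; intros (N' & E & H); apply gpow_inj in E as <-; exists N; tauto.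
  - exists 0; intros c' _; apply pbool_iff.
    split; intros (N & E & _); exfalso; apply Hn; exists N; exact E.
Qed.

Lemma branch_not_thin_wf c u : branch c c u -> ~ thin_wf G (psi c).
Proof.
  intros Hu.
  (* The invariant after n shifts: the set still contains all powers whose exponents come from
     prefixes of [u] of length at least n. *)
  assert (H : forall A, thin_wf G A -> forall n,
    ~ (forall f K, supp f K -> (forall k, f k = true -> exists i, n <= i /\ k = pres u i) ->
       A (gpow G g (val f K)) = true)).
  { induction 1 as [A [l Hl] | A _ IH]; intros n HA.
    - apply (injective_not_in_list G (fun i => gpow G g (4 ^ pres u (n + i))) l).
      + intros i j E; apply gpow_inj, Nat.pow_inj_r in E; [|lia].
        apply pres_inj in E; lia.
      + intros i; apply Hl; set (q := pres u (n + i)).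
        replace (4 ^ q) with (val (fun k => orb (Nat.eqb k q) false) (S q)).
        * apply HA; intros k Hk; rewrite Bool.orb_false_r in Hk; apply Nat.eqb_eq in Hk as ->.
          -- lia.
          -- exists (n + i); split; [lia | reflexivity].
        * rewrite (val_add (fun _ => false)) by reflexivity.
          assert (E : forall K, val (fun _ => false) K = 0)
            by (induction K as [| K IHK]; simpl; [|rewrite IHK]; reflexivity).
          rewrite E; destruct (Nat.ltb_spec q (S q)); lia.
    - set (q := pres u n); apply (IH (ginv G (gpow G g (4 ^ q)))) with (n := S n).
      + intros E; apply (g_inf (4 ^ q)).
        * apply Nat.neq_0_lt_0, Nat.pow_nonzero; lia.
        * rewrite <- (ginv_inv G (gpow G g (4 ^ q))), E.
          rewrite <- (gmul_1l G (ginv G (gone G))); apply gmul_Vr.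
      + intros f K Hf Hfu; apply capshiftE; split.
        * apply HA; [exact Hf|]; intros k Hk; destruct (Hfu k Hk) as [i [Hi E]].
          exists i; split; [lia | exact E].
        * rewrite ginv_inv, <- gpow_add.
          (* Codes increase along [u], so q is not among the later exponents and adding 4^q causes
             no carry. *)
          assert (Hq : f q = false).
          { destruct (f q) eqn:E; [|reflexivity]; destruct (Hfu q E) as [i [Hi Ei]].
            pose proof (pres_mono u n i Hi); unfold q in Ei; lia. }
          replace (4 ^ q + val f K)
            with (val (fun k => orb (Nat.eqb k q) (f k)) (Nat.max K (S q))).
          -- apply HA; intros k Hk; apply Bool.orb_true_iff in Hk as [Hk | Hk].
             ++ apply Nat.eqb_eq in Hk as ->; lia.
             ++ specialize (Hf k Hk); lia.
             ++ apply Nat.eqb_eq in Hk as ->; exists n; split; [lia | reflexivity].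
             ++ destruct (Hfu k Hk) as [i [Hi E]]; exists i; split; [lia | exact E].
          -- rewrite val_add, (val_supp f K) by (assumption || lia).
             destruct (Nat.ltb_spec q (Nat.max K (S q))); lia. }
  intros HA; apply (H _ HA 0); intros f K Hf Hfu; apply psiP.
  exists (val f K); split; [reflexivity|]; exists f, K; repeat split; [exact Hf|].
  intros k l Hk Hl; destruct (Hfu k Hk) as [i [_ Ei]], (Hfu l Hl) as [j [_ Ej]].
  exists u, i, j; repeat split; auto.
Qed.

Lemma der_le (k : nat -> G) A m n p : m <= n -> der G k A n p = true -> der G k A m p = true.
Proof.
  induction 1 as [| n _ IH]; [auto|]; intros H; apply capshiftE in H; apply IH; tauto.
Qed.

Lemma der_lt (k : nat -> G) A i n p : i < n -> der G k A n p = true ->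
  A p = true /\ A (gmul G (ginv G (k i)) p) = true.
Proof.
  intros Hi H; apply (der_le k A (S i)) in H; [|lia]; apply capshiftE in H as [H1 H2].
  split; [apply (der_le k A 0 i) | apply (der_le k A 0 i)]; (lia || assumption).
Qed.

(** The shift acts as a power of g whose exponent N - M is independent of the powers compared; the
    equation is arranged to avoid subtraction on [nat]. *)
Lemma gpow_shift_diff k N M N' M' :
  gmul G k (gpow G g M) = gpow G g N -> gmul G k (gpow G g M') = gpow G g N' ->
  N + M' = N' + M.
Proof.
  intros E E'; apply gpow_inj; rewrite !gpow_add, <- E, <- E', <- !gmul_assoc, <- !gpow_add.
  rewrite Nat.add_comm; reflexivity.
Qed.

Lemma not_thin_wf_branch c : ~ thin_wf G (psi c) -> exists u, branch c c u.
Proof.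
  intros H; apply not_thin_wfP in H; destruct H as (k & Hk & Hd).
  assert (Hne : forall n, exists p, der G k (psi c) n p = true).
  { intros n; apply NNPP; intros Hn; apply (Hd n); exists nil; intros p Hp; exfalso.
    apply Hn; exists p; exact Hp. }
  (* A point of the intersection after shift i and its preimage under that shift are both powers of
     g; their exponents differ because the shift is nontrivial, and the leading digit gives the
     node. *)
  assert (Hs : forall i, exists s N M,
             gmul G (k i) (gpow G g M) = gpow G g N /\
             top (Z.of_nat N - Z.of_nat M) s).
  { intros i; destruct (Hne (S i)) as [p Hp].
    destruct (der_lt k _ i _ p (Nat.lt_succ_diag_r i) Hp) as [H1 H2].
    apply psiP in H1 as (N & -> & f & K & Hf & -> & _).
    apply psiP in H2 as (M & E & f' & K' & Hf' & -> & _).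
    rewrite <- (val_supp f K (Nat.max K K')) in * by (assumption || lia).
    rewrite <- (val_supp f' K' (Nat.max K K')) in * by (assumption || lia).
    set (N := val f _) in *; set (M := val f' _) in *.
    assert (E' : gmul G (k i) (gpow G g M) = gpow G g N)
      by (rewrite <- E; apply gmul_KVl).
    destruct (val_sub_top f f' (Nat.max K K') _ eq_refl) as (s & _ & Ht & _).
    - fold N M; intros E0; apply (Hk i), (gmul_cancel_r G (gpow G g M)).
      rewrite E', gmul_1l; f_equal; lia.
    - exists s, N, M; split; assumption. }
  apply choice in Hs; destruct Hs as [s Hs]; apply (comp_sequence_branch c s).
  (* As i < j, the points p, k_i^-1 p, k_j^-1 p and k_i^-1 k_j^-1 p all lie in [psi c]: these are
     the corners of a parallelogram. *)
  intros i j Hij; destruct (Hne (S j)) as [p Hp].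
  destruct (der_lt k _ j _ p (Nat.lt_succ_diag_r j) Hp) as [H0 H1].
  apply capshiftE in Hp as [Hp Hpj].
  destruct (der_lt k _ i _ _ Hij Hp) as [_ H2], (der_lt k _ i _ _ Hij Hpj) as [_ H3].
  apply psiP in H0 as (N & -> & C0); apply psiP in H1 as (N1 & E1 & C1).
  apply psiP in H2 as (N2 & E2 & C2); rewrite E1 in H3.
  apply psiP in H3 as (N3 & E3 & C3).
  destruct (Hs i) as (Ni & Mi & Ei & Ti), (Hs j) as (Nj & Mj & Ej & Tj).
  assert (D1 := f_equal (gmul G (k j)) E1); assert (D2 := f_equal (gmul G (k i)) E2).
  assert (D3 := f_equal (gmul G (k i)) E3); rewrite gmul_KVl in D1, D2, D3.
  symmetry in D1, D2, D3.
  pose proof (gpow_shift_diff _ _ _ _ _ Ej D1); pose proof (gpow_shift_diff _ _ _ _ _ Ei D2).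
  pose proof (gpow_shift_diff _ _ _ _ _ Ei D3).
  assert (Hz : forall d t, top d t -> d <> 0%Z) by (unfold top; intros; lia).
  apply (chain_sum_square c (Z.of_nat Ni - Z.of_nat Mi) (Z.of_nat Nj - Z.of_nat Mj)
           (s i) (s j) N N2 N1 N3 C0 C2 C1 C3);
    try lia; eauto.
Qed.

Lemma tau_star_psi c : tau_star G (finite_sets G) (psi c) <-> ~ exists u, branch c c u.
Proof.
  rewrite tau_starP; split.
  - intros H [u Hu]; exact (branch_not_thin_wf c u Hu H).
  - intros H; apply NNPP; intros Hn; apply H, not_thin_wf_branch, Hn.
Qed.

Lemma tau_star_not_sigma11 : ~ sigma11 (fun c => tau_star G (finite_sets G) (psi c)).
Proof.
  intros H; apply sigma11_diagonal; revert H; apply sigma11_ext, tau_star_psi.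
Qed.

End Reduction.

Theorem theorem1p4 (G : Group) (HG : countable_type G) :
  (forall a : ord, borel G (tau_iter G (finite_sets G) a)) /\
  (forall A, tau_star G (finite_sets G) A <-> tau_lt_omega1 G (finite_sets G) A) /\
  coanalytic G (tau_star G (finite_sets G)) /\
  ((exists g : G, infinite_order G g) ->
     ~ analytic G (tau_star G (finite_sets G)) /\
     ~ borel G (tau_star G (finite_sets G))).
Proof.
  destruct HG as [e He]; split; [|split; [|split]].
  - intros a; apply (borel_tau_iter G e He), (borel_finite G e He).
  - exact (tau_star_lt_omega1 G e He).
  - exact (coanalytic_tau_star G e He).
  (* Either property would pull back along [psi] to a [sigma11] set. *)
  - intros [g Hg]; split; intros H; apply (tau_star_not_sigma11 G g Hg).
    + exact (analytic_sigma11 G _ (psi_local G g Hg) _ H).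
    + exact (proj1 (borel_sigma11 G _ (psi_local G g Hg) _ H)).
Qed.
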